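(* Let $\varrho=\frac12\delta_{-1}+\frac12\delta_1$ and $\beta=1$. Then there is an absolute constant $C$ such that for all $n\ge1$ $$\sup_{z\in\mathbb{R}}\Big|P_n\big(S_n/n^{3/4}\le z\big)-F(z)\Big|\le C\,n^{-1/2},$$ where $$F(z):=\frac1Z\int_{-\infty}^z\exp(-x^4/12)\,dx,\qquad Z:=\int_{\mathbb{R}}\exp(-x^4/12)\,dx .$$
   Context: Classical Curie–Weiss model: for $\beta>0$ and $n\ge1$, $P_n=P_{n,\beta}$ is the probability measure on $\{-1,+1\}^n$ under which the spins $(X_1,\dots,X_n)$ have the law $$dP_{n,\beta}(x)=\frac{1}{Z_n(\beta)}\exp\Big(\frac{\beta}{2n}\big(\sum_{i=1}^n x_i\big)^2\Big)\prod_{i=1}^n d\varrho(x_i),$$ with normalizing constant $Z_n(\beta)$. $S_n=\sum_{i=1}^n X_i$. *)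

(* Defs.v *)
From HB Require Import structures.
From mathcomp Require Import all_boot all_order all_algebra.
From mathcomp Require Import all_classical all_reals all_analysis.
Set Implicit Arguments.
Unset Strict Implicit.
Unset Printing Implicit Defensive.
Import Order.TTheory GRing.Theory Num.Theory.
Import numFieldNormedType.Exports.
Local Open Scope classical_set_scope.
Local Open Scope ring_scope.

(* A configuration in {-1,+1}^n is an n.-tuple of booleans (true for +1, false
   for -1), with the product sigma-algebra. *)
Definition spin {R : realType} (b : bool) : R := if b then 1 else - 1%R.

Definition rho {R : realType} : {measure set R -> \bar R} :=
  measure_add (mscale (2^-1)%:nng (dirac (- 1%R : R)))
              (mscale (2^-1)%:nng (dirac (1%R : R))).

Lemma rho_spin {R : realType} (b : bool) : rho [set spin b] = (2^-1 : R)%:E.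
Proof.
have n1 : (1 : R) == - 1%R = false.
  by rewrite gt_eqF// (lt_trans ltrN10) ?ltr01.
rewrite /rho [LHS]measure_addE /= /mscale/= !diracE !classical_sets.in_set1; case: b; rewrite /spin.
- by rewrite eq_sym n1 eqxx mule0 mule1 add0e.
- by rewrite n1 eqxx mule0 mule1 adde0.
Qed.

Section curie_weiss.
Context {R : realType} (n : nat).
Local Notation conf := (n.-tuple bool).

Definition cw_X (i : 'I_n) (x : conf) : R := spin (tnth x i).

Definition cw_S (x : conf) : R := \sum_(i < n) cw_X i x.

Lemma measurable_cw_X (i : 'I_n) : measurable_fun [set: conf] (cw_X i).
Proof.
by apply: (@measurableT_comp _ _ _ _ _ _ spin) => //; exact: measurable_tnth.
Qed.

HB.instance Definition _ (i : 'I_n) :=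
  isMeasurableFun.Build _ _ conf R (cw_X i) (measurable_cw_X i).

Lemma measurable_cw_S : measurable_fun [set: conf] cw_S.
Proof. by apply: measurable_sum => i; exact: measurable_cw_X. Qed.

HB.instance Definition _ :=
  isMeasurableFun.Build _ _ conf R cw_S measurable_cw_S.

Variable beta : R.

(* Since the product of n copies of rho is atomic on {-1,+1}^n, the law with a
   density with respect to it is given by its point masses. *)
Definition cw_weight (x : conf) : R :=
  expR (beta / (2 * n%:R) * cw_S x ^+ 2) *
  \prod_(i < n) fine (rho [set cw_X i x]).

Definition cw_Z : R := \sum_(x : conf) cw_weight x.

Definition cw_prob (A : set conf) : \bar R :=
  (\sum_(x : conf) (cw_weight x / cw_Z)%:E * \d_x A)%E.

Lemma cw_weight_gt0 x : 0 < cw_weight x.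
Proof.
rewrite mulr_gt0 ?expR_gt0// prodr_gt0// => i _.
by rewrite rho_spin/= invr_gt0.
Qed.

Lemma cw_Z_gt0 : 0 < cw_Z.
Proof.
rewrite /cw_Z (bigD1 [tuple of nseq n true])//= ltr_pwDl ?cw_weight_gt0//.
by apply: sumr_ge0 => x _; exact/ltW/cw_weight_gt0.
Qed.

Let cw_pmf_ge0 x : 0 <= cw_weight x / cw_Z.
Proof. by rewrite divr_ge0// ltW// ?cw_weight_gt0 ?cw_Z_gt0. Qed.

Let cw_prob0 : cw_prob set0 = 0%E.
Proof. by rewrite /cw_prob big1// => x _; rewrite measure0 mule0. Qed.

Let cw_prob_ge0 A : (0 <= cw_prob A)%E.
Proof. by apply: sume_ge0 => x _; rewrite mule_ge0// lee_fin cw_pmf_ge0. Qed.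

Let cw_prob_sigma_additive : semi_sigma_additive cw_prob.
Proof.
move=> F mF tF mUF; rewrite /cw_prob.
under eq_fun do rewrite exchange_big/=.
apply: cvg_nnesum => [x _|x _].
- by apply: nearW => k; apply: sume_ge0 => j _; rewrite mule_ge0// lee_fin cw_pmf_ge0.
- have := @measure_semi_sigma_additive _ _ _
    (mscale (NngNum (cw_pmf_ge0 x)) (dirac x)) F mF tF mUF.
  by [].
Qed.

HB.instance Definition _ := isMeasure.Build _ conf R cw_prob
  cw_prob0 cw_prob_ge0 cw_prob_sigma_additive.

Let cw_prob_setT : cw_prob [set: conf] = 1%E.
Proof.
rewrite /cw_prob.
under eq_bigr do rewrite diracT mule1.
by rewrite sumEFin -mulr_suml divff// gt_eqF// cw_Z_gt0.
Qed.

HB.instance Definition _ :=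
  Measure_isProbability.Build _ conf R cw_prob cw_prob_setT.

End curie_weiss.

Definition quartic_Z {R : realType} : R :=
  \int[lebesgue_measure]_(x in [set: R]) expR (- (x ^+ 4 / 12)).

Definition quartic_F {R : realType} (z : R) : R :=
  quartic_Z^-1 * \int[lebesgue_measure]_(x in `]-oo, z]) expR (- (x ^+ 4 / 12)).

(* Main.v *)
Require Import Defs.
From mathcomp Require Import all_boot all_order all_algebra ring lra zify.
From mathcomp Require Import all_classical all_reals all_analysis.
From mathcomp Require Import measurable_realfun.
Import Order.TTheory GRing.Theory Num.Theory.
Import numFieldNormedType.Exports.
Local Open Scope classical_set_scope.
Local Open Scope ring_scope.

(** The law of [S_n] lives on the lattice of the values [s = 2k - n], where it
    has weights [v_k = 'C(n, k) exp (s^2 / 2n)] up to normalization. The proof is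
    a local limit theorem with rate for these weights, followed by a Riemann sum.
    The normalization drops out in the end, so that only ratios of consecutive
    weights matter, and they are explicit: with [t = s + 1] and [u = t / (n + 1)],
      [v_(k+1) / v_k = (1 - u) / (1 + u) * exp (2 t / n)],
    whose logarithm is [2 t / n - 2 artanh u = - 2 t^3 / 3 n^3] up to terms of
    order [t / n^2] and [t^5 / n^5]: at the critical temperature the linear terms
    cancel, and the cubic term that remains is the increment of
    [- s^4 / 12 n^3 = - x^4 / 12] with [x = s / n^(3/4)].

    Summing the increments from the centre of the lattice upwards
    ([mag_telescope]), and using the symmetry [s -> - s] for the lower half, gives
      [v_k = v_centre * exp (- x^4 / 12 + delta)] with
      [- x^6 / sqrt n <= delta <= 5/4 * x^2 / sqrt n],
    the lower bound as long as [|s| <= n / 2]. As [x^2 <= sqrt n], the upper bound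
    is at most [5/4], so [delta] never spoils the decay of [exp (- x^4 / 12)], and
    beyond [n / 2] the quartic density is itself smaller than the error allowed.
    Hence the rescaled weights differ from the quartic density by at most
    [C / sqrt n] times the Cauchy density [1 / (1 + x^2)] ([mag_weight_close]).

    This last bound is integrable, so integrating it over the cells of width
    [h = 2 / n^(3/4)] between lattice points compares every partial sum with the
    integral of the quartic density, with total error [O(1 / sqrt n)] plus one
    incomplete cell ([lattice_sum]). Dividing by the same comparison for the whole
    line ([lattice_sumT], [normalized_dist]) gives the theorem. *)

(** * Elementary estimates *)

(** Linear control of [expR d - 1] that stays useful for large [d], as long as
    an upper bound [M] on [d] is known. *)
Lemma expR_near1 {R : realType} (d M : R) :
  0 <= M -> d <= M -> 0 <= d -> expR d - 1 <= d * expR M.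
Proof.
move=> M0 dM d0; apply: (@le_trans _ _ (d * expR d)); last first.
  by apply: ler_wpM2l => //; rewrite ler_expR.
have h := expR_ge1Dx (- d); have e := expR_gt0 d.
have : (1 - d) * expR d <= expR (- d) * expR d by rewrite ler_pM2r.
by rewrite expRN mulVf ?gt_eqF// mulrBl mul1r; lra.
Qed.

(** Differentiability up to the end points also supplies the continuity that the
    mean value theorem asks for. *)
Lemma MVT_is_derive {R : realType} {f df : R -> R} {a b : R} : a <= b ->
  (forall x, a <= x <= b -> is_derive x 1 f (df x)) ->
  exists2 c, a <= c <= b & f b - f a = df c * (b - a).
Proof.
move=> ab fdf; have [x||c] := @MVT_segment R f df a b ab; last first.
- by rewrite in_itv/= => cab fab; exists c.
- apply: continuous_in_subspaceT => x; rewrite inE/= in_itv/= => xab.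
  apply: differentiable_continuous; apply/derivable1_diffP.
  exact: (@ex_derive _ _ _ _ _ _ _ (fdf _ xab)).
- by rewrite in_itv/= => /andP[ax xb]; apply: fdf; rewrite !ltW.
Qed.

Section artanh.
Context {R : realType}.
Implicit Type u : R.

Let L u : R := ln (1 + u) - ln (1 - u).

Let is_derive_L u : -1 < u < 1 -> is_derive u 1 L (2 / (1 - u ^+ 2)).
Proof.
move=> /andP[u1 u2].
have h1 : 0 < 1 + u by lra.
have h2 : 0 < 1 - u by lra.
have d1 : is_derive u 1 (fun x : R => ln (1 + x)) (1 + u)^-1.
  have dl := is_derive1_ln h1.
  have da : is_derive u 1 (fun x : R => 1 + x) 1.
    by apply: is_derive_eq; rewrite add0r mul1r.
  by have := is_derive1_comp dl da; rewrite mulr1.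
have d2 : is_derive u 1 (fun x : R => ln (1 - x)) (- (1 - u)^-1).
  have dl := is_derive1_ln h2.
  have da : is_derive u 1 (fun x : R => 1 - x) (- 1).
    by apply: is_derive_eq; rewrite add0r mul1r.
  by have := @is_derive1_comp _ (@ln R) (fun x : R => 1 - x) _ _ _ dl da; rewrite mulrN1.
rewrite /L; apply: is_derive_eq.
by field; apply/and3P; split; apply/eqP; nra.
Qed.

(** Comparison of derivatives with those of the truncated series of
    [2 * artanh u]. All the terms of the series are nonnegative, whence the lower
    bound; the restriction to [u <= 1 / 2] makes its tail comparable to [u ^+ 5]. *)
Lemma artanh_bounds {u} : 0 <= u < 1 ->
  2 * u + 2 / 3 * u ^+ 3 <= ln (1 + u) - ln (1 - u) /\
  (u <= 1 / 2 -> ln (1 + u) - ln (1 - u) <= 2 * u + 2 / 3 * u ^+ 3 + u ^+ 5).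
Proof.
move=> /andP[u0 u1]; have L0 : L 0 = 0 by rewrite /L addr0 subr0 subrr.
split=> [|u2].
  have dlow x : 0 <= x <= u -> is_derive x 1
      (fun x => L x - (2 * x + 2 / 3 * x ^+ 3))
      (2 / (1 - x ^+ 2) - (2 + 2 * x ^+ 2)).
    move=> /andP[x0 xu].
    have dL : is_derive x 1 L (2 / (1 - x ^+ 2)).
      by apply: is_derive_L; apply/andP; split; lra.
    by apply: is_derive_eq; rewrite /GRing.scale /=; lra.
  have [c /andP[c0 cu]] := MVT_is_derive u0 dlow.
  rewrite L0 !expr0n/= -/(L u) => h.
  have c1 : 0 < 1 - c ^+ 2 by nra.
  suff : 0 <= (2 / (1 - c ^+ 2) - (2 + 2 * c ^+ 2)) * (u - 0) by lra.
  apply: mulr_ge0; last by lra.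
  by rewrite subr_ge0 ler_pdivlMr//; nra.
have dup x : 0 <= x <= u -> is_derive x 1
    (fun x => 2 * x + 2 / 3 * x ^+ 3 + x ^+ 5 - L x)
    (2 + 2 * x ^+ 2 + 5 * x ^+ 4 - 2 / (1 - x ^+ 2)).
  move=> /andP[x0 xu].
  have dL : is_derive x 1 L (2 / (1 - x ^+ 2)).
    by apply: is_derive_L; apply/andP; split; lra.
  by apply: is_derive_eq; rewrite /GRing.scale /=; lra.
have [c /andP[c0 cu]] := MVT_is_derive u0 dup.
rewrite L0 !expr0n/= -/(L u) => h.
have c1 : c ^+ 2 <= 1 / 4 by nra.
suff : 0 <= (2 + 2 * c ^+ 2 + 5 * c ^+ 4 - 2 / (1 - c ^+ 2)) * (u - 0) by lra.
apply: mulr_ge0; last by lra.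
rewrite subr_ge0 ler_pdivrMr; last by lra.
rewrite (_ : c ^+ 4 = (c ^+ 2) ^+ 2); last by rewrite -exprM.
move: (c ^+ 2) (sqr_ge0 c) c1 => v v0 v1.
by nra.
Qed.

(** The two forms in which the expansion of [artanh] enters the ratio of
    consecutive spin weights. *)
Lemma ratio_bounds {u} : 0 <= u < 1 ->
  (1 - u) / (1 + u) <= expR (- (2 * u + 2 / 3 * u ^+ 3)) /\
  (u <= 1 / 2 ->
   expR (- (2 * u + 2 / 3 * u ^+ 3 + u ^+ 5)) <= (1 - u) / (1 + u)).
Proof.
move=> u01; have [lo up] := artanh_bounds u01.
case/andP: u01 => u0 u1.
have h1 : 0 < 1 + u by lra.
have h2 : 0 < 1 - u by lra.
have -> : (1 - u) / (1 + u) = expR (- (ln (1 + u) - ln (1 - u))).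
  by rewrite opprB expRB !lnK.
by rewrite !ler_expR !lerN2; split.
Qed.

End artanh.

(** * The quartic density *)

Section quartic.
Context {R : realType}.
Implicit Types x y : R.

Definition quartic x : R := expR (- (x ^+ 4 / 12)).

Lemma quartic_ge0 x : 0 <= quartic x. Proof. exact: expR_ge0. Qed.

Lemma exprn4_ge0 x : 0 <= x ^+ 4.
Proof. by rewrite exprn_even_ge0. Qed.

Lemma quartic_le1 x : quartic x <= 1.
Proof. by rewrite -expR0 ler_expR; have := exprn4_ge0 x; lra. Qed.

(** [576 = 24 ^ 2]: the exponential is split into two factors
    [expR (- x ^+ 4 / 24)], each of which beats [1 + x ^+ 4]. *)
Lemma quartic_decay x : quartic x * (1 + x ^+ 4) ^+ 2 <= 576.
Proof.
have t0 := exprn4_ge0 x; rewrite /quartic.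
move: (x ^+ 4) t0 => t t0.
have -> : - (t / 12) = 2%:R * - (t / 24) by lra.
rewrite expRM_natl -exprMn.
have e0 := expR_ge0 (- (t / 24)).
have : expR (- (t / 24)) * (1 + t) <= 24.
  apply: (@le_trans _ _ (expR (- (t / 24)) * (24 * (1 + t / 24)))).
    by apply: ler_wpM2l => //; lra.
  rewrite mulrCA; have := expR_ge1Dx (t / 24) => h.
  have : expR (- (t / 24)) * (1 + t / 24) <= expR (- (t / 24)) * expR (t / 24).
    exact: ler_wpM2l.
  by rewrite -expRD addNr expR0; lra.
have : 0 <= expR (- (t / 24)) * (1 + t) by apply: mulr_ge0 => //; lra.
by move: (_ * _) => z z0 z24; nra.
Qed.

(** The Cauchy density serves as the integrable majorant throughout. It is
    preferred to a faster decaying one because it changes only by a constant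
    factor within a lattice cell, see [oneDsqrV_shift]. *)
Lemma quartic_decay_div x p :
  0 <= p -> p * (1 + x ^+ 2) <= 2 * (1 + x ^+ 4) ^+ 2 ->
  p * quartic x <= 1152 * (oneDsqr x)^-1.
Proof.
move=> p0 hp; have d0 : 0 < oneDsqr x by rewrite (lt_le_trans ltr01)// oneDsqr_ge1.
rewrite ler_pdivlMr// /oneDsqr mulrAC.
apply: (@le_trans _ _ (2 * (1 + x ^+ 4) ^+ 2 * quartic x)).
  by apply: ler_wpM2r => //; exact: quartic_ge0.
by have := quartic_decay x; rewrite -mulrA [_ ^+ 2 * _]mulrC; lra.
Qed.

Lemma is_derive_quartic x :
  is_derive x 1 quartic (- (x ^+ 3 / 3) * quartic x).
Proof.
rewrite /quartic; apply: is_derive_eq.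
by rewrite /GRing.scale /=; field.
Qed.

Lemma oneDsqrV_shift x y : `|x - y| <= 2 -> (oneDsqr x)^-1 <= 9 * (oneDsqr y)^-1.
Proof.
move=> /ler_normlP[h1 h2].
rewrite /oneDsqr -[leLHS]mul1r ler_pdivrMr; last by nra.
rewrite mulrAC ler_pdivlMr; last by nra.
have : (y - x) ^+ 2 <= 4 by nra.
have := sqr_ge0 (y - 2 * x); have := sqr_ge0 x; have := sqr_ge0 y; nra.
Qed.

(** The mean value theorem, with the derivative evaluated at an intermediate
    point and then transported to [y]; [10368 = 9 * 1152]. *)
Lemma quartic_lip x y h : h <= 2 -> x - h <= y <= x ->
  `|quartic x - quartic y| <= 10368 * h * (oneDsqr y)^-1.
Proof.
move=> h2 /andP[xhy yx].
have [c /andP[yc cx] ->] := MVT_is_derive yx (fun z _ => is_derive_quartic z).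
have x_y : `|x - y| <= h by rewrite ler_norml; apply/andP; split; lra.
have gc : (oneDsqr c)^-1 <= 9 * (oneDsqr y)^-1.
  by apply: oneDsqrV_shift; apply/ler_normlP; split; lra.
have dc : `|- (c ^+ 3 / 3) * quartic c| <= 1152 * (oneDsqr c)^-1.
  rewrite normrM normrN normrM normrX (ger0_norm (quartic_ge0 c)).
  rewrite (@ger0_norm _ 3^-1)//; apply: quartic_decay_div.
    by rewrite mulr_ge0// exprn_ge0.
  have -> : c ^+ 2 = `|c| ^+ 2 by rewrite -normrX ger0_norm// sqr_ge0.
  have -> : c ^+ 4 = (`|c| ^+ 2) ^+ 2.
    by rewrite -exprM -normrX ger0_norm// exprn4_ge0.
  rewrite exprSr; move: (`|c|) (normr_ge0 c) => m m0.
  have e1 : m * m ^+ 2 <= 1 + (m ^+ 2) ^+ 2.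
    by have := sqr_ge0 (m - 1); have := sqr_ge0 (m ^+ 2 - 1); nra.
  have e2 : 1 + m ^+ 2 <= 3 / 2 * (1 + (m ^+ 2) ^+ 2).
    by have := sqr_ge0 (m ^+ 2 - 1); nra.
  have e0 : 0 <= m * m ^+ 2 by rewrite mulr_ge0// exprn_ge0.
  by have := sqr_ge0 m; nra.
rewrite normrM.
have {gc} : 1152 * (oneDsqr c)^-1 <= 1152 * (9 * (oneDsqr y)^-1).
  by apply: ler_wpM2l gc; rewrite ler0n.
move=> /(le_trans dc) {}dc.
apply: (le_trans (ler_pM (normr_ge0 _) (normr_ge0 _) dc x_y)).
by rewrite le_eqVlt; apply/predU1P; left; ring.
Qed.

(** The factor [x ^+ 2 + x ^+ 6] is the relative error produced by the expansion
    of the spin weights. *)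
Lemma poly_quartic_le x :
  (x ^+ 2 + x ^+ 6) * quartic x <= 1152 * (oneDsqr x)^-1.
Proof.
apply: quartic_decay_div.
  by rewrite addr_ge0 ?exprn_even_ge0.
have -> : x ^+ 6 = (x ^+ 2) ^+ 3 by rewrite -exprM.
have -> : x ^+ 4 = (x ^+ 2) ^+ 2 by rewrite -exprM.
move: (x ^+ 2) (sqr_ge0 x) => v v0.
rewrite [leLHS](_ : _ = (v + v ^+ 2 * v) + (v ^+ 2 + (v ^+ 2) ^+ 2)); last by ring.
by have := sqr_ge0 (v - 1); have := sqr_ge0 (v ^+ 2 - v);
  have := sqr_ge0 (v ^+ 2); nra.
Qed.

(** The rescaled lattice ends at distance [a = n ^ (1/4)] from the origin; further
    out the density itself has to be within the error. *)
Lemma quartic_tail a x : 0 < a -> a <= `|x| ->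
  quartic x <= 1152 / a ^+ 2 * (oneDsqr x)^-1.
Proof.
move=> a0 ax; rewrite mulrAC ler_pdivlMr ?exprn_gt0//.
apply: le_trans (poly_quartic_le x); rewrite mulrC.
apply: ler_wpM2r; first exact: quartic_ge0.
have : a ^+ 2 <= x ^+ 2.
  by rewrite -[x ^+ 2]ger0_norm ?sqr_ge0// normrX ler_pXn2r ?nnegrE// ltW.
have : 0 <= x ^+ 6 by rewrite exprn_even_ge0.
lra.
Qed.

End quartic.

(** * Spin weights along the lattice of magnetizations *)

Section weights.
Context {R : realType}.
Variable n : nat.
Hypothesis n0 : (0 < n)%N.

(** The value of [S_n] when [k] spins are up. *)
Definition mag (k : nat) : R := 2 * k%:R - n%:R.

(** The total weight of the configurations with [k] spins up, without the factor
    [2 ^- n]. *)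
Definition mag_weight (k : nat) : R :=
  'C(n, k)%:R * expR (mag k ^+ 2 / (2 * n%:R)).

Local Notation s := mag.
Local Notation v := mag_weight.
Local Notation N := (n%:R : R).

Lemma mag_weight_gt0 {k} : (k <= n)%N -> 0 < v k.
Proof. by move=> kn; rewrite mulr_gt0 ?expR_gt0// ltr0n bin_gt0. Qed.

Lemma mag_rev {k} : (k <= n)%N -> mag (n - k) = - mag k.
Proof. by move=> kn; rewrite /mag natrB//; lra. Qed.

Lemma mag_weight_rev {k} : (k <= n)%N -> v (n - k) = v k.
Proof. by move=> kn; rewrite /mag_weight mag_rev// sqrrN bin_sub. Qed.

Lemma magS k : mag k.+1 = mag k + 2.
Proof. by rewrite /mag -natr1; lra. Qed.

Let N1 : 1 <= N. Proof. by rewrite ler1n. Qed.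

Let Nn0 : N != 0. Proof. by rewrite pnatr_eq0 -lt0n. Qed.

Let NSn0 : N + 1 != 0. Proof. by rewrite natr1 pnatr_eq0. Qed.

Lemma mag_weightS {k} : (k < n)%N ->
  let u := (s k + 1) / (N + 1) in
  v k.+1 = v k * ((1 - u) / (1 + u) * expR (2 * (s k + 1) / N)).
Proof.
move=> kn u; rewrite /mag_weight.
have -> : expR (s k.+1 ^+ 2 / (2 * N)) =
    expR (s k ^+ 2 / (2 * N)) * expR (2 * (s k + 1) / N).
  rewrite -expRD; congr expR; rewrite magS; field; exact: Nn0.
have k0 : 0 <= k%:R :> R by [].
have -> : 'C(n, k.+1)%:R = 'C(n, k)%:R * ((1 - u) / (1 + u)).
  have : (k.+1 * 'C(n, k.+1))%:R = ((n - k) * 'C(n, k))%:R :> R.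
    by rewrite mul_bin_left.
  rewrite !natrM natrB ?(ltnW kn)// -natr1 => e.
  have k1 : k%:R + 1 != 0 :> R by rewrite natr1 pnatr_eq0.
  apply: (mulfI k1); rewrite e /u /mag; field.
  rewrite NSn0 /= gt_eqF//; lra.
by ring.
Qed.

(** The quadratic potential in the bound comes from the three corrections to
    [- 2 / 3 * t ^+ 3 / n ^+ 3], where [t = s k + 1]: the failure [2 * t / n - 2 * u]
    of the linear terms to cancel exactly, the replacement of [n + 1] by [n] in the
    cubic term, and the term linear in [t] of the increment of [s ^+ 4]. They
    contribute at most [2 + 2 + 2 / 3 <= 5] times [t / n ^+ 2], while the increment of
    [s ^+ 2] is [4 * t]. *)
Lemma mag_step_upper {k} : (k < n)%N -> 0 <= s k ->
  v k.+1 <= v k * expR (- (s k.+1 ^+ 4 - s k ^+ 4) / (12 * N ^+ 3)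
                        + 5 / 4 * ((s k.+1 ^+ 2 - s k ^+ 2) / N ^+ 2)).
Proof.
move=> kn s0; have kn' : k%:R + 1 <= N :> R by rewrite natr1 ler_nat.
rewrite mag_weightS// magS /=; move: s0.
have : s k + 1 <= N - 1 by rewrite /mag; lra.
set t := s k + 1; rewrite (_ : s k = t - 1); last by rewrite /t; lra.
move=> tn s0.
have u01 : 0 <= t / (N + 1) < 1.
  by rewrite divr_ge0 ?ltr_pdivrMr/=; lra.
apply: ler_wpM2l; first exact/ltW/mag_weight_gt0/ltnW.
have [+ _] := ratio_bounds u01.
move/(ler_wpM2r (expR_ge0 (2 * t / N))) => /le_trans; apply.
rewrite -expRD ler_expR.
have NN : N * N^-1 = 1 by rewrite divff.
have RR : (N + 1) * (N + 1)^-1 = 1 by rewrite divff.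
rewrite invfM !exprMn -!exprVn.
have r0 : 0 < (N + 1)^-1 by rewrite invr_gt0; lra.
have m0 : 0 < N^-1 by rewrite invr_gt0; lra.
move: (N^-1) ((N + 1)^-1) NN RR r0 m0 => m r NN RR r0 m0.
(* [m = n^-1] and [r = (n + 1)^-1] from here on *)
have mr : m - r = m * r.
  have : m * ((N + 1) * r) - (N * m) * r = m - r by rewrite NN RR; ring.
  by lra.
have rm : r <= m by nra.
have m1 : m <= 1 by nra.
have tm : t * m <= 1 by rewrite -NN; apply: ler_wpM2r; lra.
have t0 : 0 <= t by lra.
have p1 : t * (m - r) <= t * m ^+ 2 by apply: ler_wpM2l => //; rewrite mr expr2; nra.
have p2 : m ^+ 3 - r ^+ 3 <= 3 * m ^+ 4.
  have -> : m ^+ 3 - r ^+ 3 = (m * r) * (m ^+ 2 + m * r + r ^+ 2).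
    by rewrite -[X in X * _]mr; ring.
  have e1 : m * r <= m ^+ 2 by rewrite expr2; nra.
  have e2 : r ^+ 2 <= m ^+ 2 by rewrite ler_pXn2r// nnegrE ltW.
  have e3 : 0 <= m * r by nra.
  have -> : m ^+ 4 = m ^+ 2 * m ^+ 2 by ring.
  by have := sqr_ge0 m; nra.
have p3 : t ^+ 3 * (m ^+ 3 - r ^+ 3) <= 3 * (t * m ^+ 2).
  apply: (@le_trans _ _ (t ^+ 3 * (3 * m ^+ 4))).
    by apply: ler_wpM2l => //; rewrite exprn_ge0.
  have -> : t ^+ 3 * (3 * m ^+ 4) = 3 * (t * m ^+ 2) * (t * m) ^+ 2 by ring.
  have tm0 : 0 <= t * m by nra.
  have : 0 <= t * m ^+ 2 by apply: mulr_ge0 => //; exact: sqr_ge0.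
  have : (t * m) ^+ 2 <= 1 by rewrite expr_le1.
  by move: ((t * m) ^+ 2) => z z1; nra.
have p4 : t * m ^+ 3 <= t * m ^+ 2.
  by apply: ler_wpM2l => //; rewrite exprS; have := sqr_ge0 m; nra.
nra.
Qed.

(** Here the neglected terms have the good sign, except for the [u ^+ 5] of the
    expansion, which the increment of [s ^+ 6], at least [12 * t ^+ 5], absorbs. *)
Lemma mag_step_lower {k} : (k < n)%N -> 0 <= s k -> 2 * s k.+1 <= N ->
  v k * expR (- (s k.+1 ^+ 4 - s k ^+ 4) / (12 * N ^+ 3)
              - (s k.+1 ^+ 6 - s k ^+ 6) / N ^+ 5) <= v k.+1.
Proof.
move=> kn s0; rewrite mag_weightS// magS /=; move: s0.
set t := s k + 1; rewrite (_ : s k = t - 1); last by rewrite /t; lra.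
move=> s0 tn.
have u01 : 0 <= t / (N + 1) < 1.
  by rewrite divr_ge0 ?ltr_pdivrMr/=; lra.
have u2 : t / (N + 1) <= 1 / 2 by rewrite ler_pdivrMr; lra.
apply: ler_wpM2l; first exact/ltW/mag_weight_gt0/ltnW.
have [_ /(_ u2)] := ratio_bounds u01.
move/(ler_wpM2r (expR_ge0 (2 * t / N))); apply: le_trans.
rewrite -expRD ler_expR.
rewrite invfM !exprMn -!exprVn.
have r0 : 0 < (N + 1)^-1 by rewrite invr_gt0; lra.
have rm : (N + 1)^-1 <= N^-1 by rewrite lef_pV2 ?posrE; lra.
move: (N^-1) ((N + 1)^-1) rm r0 => m r rm r0.
have t0 : 0 <= t by lra.
have m0 : 0 <= m by lra.
have p1 : t * r <= t * m by exact: ler_wpM2l.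
have p3 : t ^+ 3 * r ^+ 3 <= t ^+ 3 * m ^+ 3.
  by apply: ler_wpM2l; [exact: exprn_ge0|rewrite ler_pXn2r// nnegrE ltW].
have p5 : t ^+ 5 * r ^+ 5 <= t ^+ 5 * m ^+ 5.
  by apply: ler_wpM2l; [exact: exprn_ge0|rewrite ler_pXn2r// nnegrE ltW].
have q1 : 0 <= t * m ^+ 3 by rewrite mulr_ge0// exprn_ge0.
have q2 : 0 <= t ^+ 5 * m ^+ 5 by rewrite mulr_ge0 ?exprn_ge0.
have q3 : 0 <= t ^+ 3 * m ^+ 5 by rewrite mulr_ge0 ?exprn_ge0.
have q4 : 0 <= t * m ^+ 5 by rewrite mulr_ge0 ?exprn_ge0.
by lra.
Qed.

Lemma mag_half : s (uphalf n) = (odd n)%:R.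
Proof.
have : N = (odd n)%:R + 2 * (n./2)%:R.
  by rewrite -{1}[n]odd_double_half -mul2n natrD natrM.
by rewrite /mag uphalf_half natrD; lra.
Qed.

(** The recursion starts at the centre of the lattice, where [s] is [0] or [1]
    according to the parity of [n]. *)
Lemma mag_telescope {j} : (uphalf n + j <= n)%N ->
  let k := (uphalf n + j)%N in
  [/\ 0 <= s k,
   v k <= v (uphalf n) * expR (- (s k ^+ 4) / (12 * N ^+ 3)
                               + 5 / 4 * (s k ^+ 2 / N ^+ 2)) &
   2 * s k <= N ->
   v (uphalf n) * expR (- (s k ^+ 4) / (12 * N ^+ 3) - s k ^+ 6 / N ^+ 5)
     <= v k].
Proof.
elim: j => [|j ih].
  rewrite addn0 => hn /=; rewrite mag_half; split=> //.
    apply: ler_peMr; first exact: ltW (mag_weight_gt0 hn).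
    rewrite -[leLHS]expR0 ler_expR.
    case: (odd n) => /=; rewrite ?expr1n ?expr0n/= ?mul0r ?oppr0 ?mul0r ?mulr0 ?addr0//.
    rewrite mulN1r invfM -!exprVn.
    have m1 : N^-1 <= 1 by rewrite invf_le1 ?ltr0n.
    have m0 : 0 < N^-1 by rewrite invr_gt0 ltr0n.
    by move: (N^-1) m0 m1 => m m0 m1; rewrite (exprS _ 2); have := sqr_ge0 m; nra.
  move=> _; apply: ler_piMr; first exact: ltW (mag_weight_gt0 hn).
  rewrite -[leRHS]expR0 ler_expR.
  have o0 : 0 <= (odd n)%:R :> R by [].
  by rewrite mulNr -opprD oppr_le0 addr_ge0.
rewrite addnS => hn /=.
have [s0 up lo] := ih (ltnW hn).
split.
- by rewrite magS; lra.
- apply: (le_trans (mag_step_upper hn s0)).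
  apply: le_trans (_ : _ <= v (uphalf n) * expR _ * _) _.
    by apply: ler_wpM2r up; exact: expR_ge0.
  rewrite -mulrA -expRD ler_wpM2l ?ler_expR//; last by lra.
  apply/ltW/mag_weight_gt0/(leq_trans _ hn)/leqW/leq_addr.
- move=> s2; apply: le_trans (mag_step_lower hn s0 s2).
  apply: le_trans (_ : _ <= v (uphalf n) * expR _ * _) _; last first.
    apply: ler_wpM2r; [exact: expR_ge0|apply: lo].
    by move: s2; rewrite magS; lra.
  rewrite -mulrA -expRD ler_wpM2l ?ler_expR//; last by lra.
  apply/ltW/mag_weight_gt0/(leq_trans _ hn)/leqW/leq_addr.
Qed.

End weights.

(** * Riemann sums with an integrable error *)

Lemma initial_segment {R : realType} (x : nat -> R) (N : nat) (z : R) :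
  {homo x : i j / (i <= j)%N >-> i <= j} ->
  exists2 m, (m <= N)%N & forall k, (k < N)%N -> (x k <= z) = (k < m)%N.
Proof.
move=> hx; elim: N => [|N [m mN ih]]; first by exists 0%N.
have [xz|xz] := leP (x N) z.
  exists N.+1 => // k; rewrite ltnS => kN.
  by rewrite kN (le_trans _ xz)// hx.
exists m; first exact: leqW.
move=> k; rewrite ltnS leq_eqVlt => /predU1P[->|/ih//].
by rewrite leNgt xz ltnNge mN.
Qed.

Section quadrature.
Context {R : realType}.
Local Notation mu := (@lebesgue_measure R).
Variables f g : R -> R.
Hypothesis intf : mu.-integrable [set: R] (EFin \o f).
Hypothesis intg : mu.-integrable [set: R] (EFin \o g).

Let intW (h : R -> R) (D : set R) : mu.-integrable [set: R] (EFin \o h) ->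
  measurable D -> mu.-integrable D (EFin \o h).
Proof. by move=> ih mD; apply: integrableS ih. Qed.

Lemma Rintegral_split {h : R -> R} {a b : R} :
  mu.-integrable [set: R] (EFin \o h) -> a <= b ->
  \int[mu]_(x in `]-oo, b]) h x =
  \int[mu]_(x in `]-oo, a]) h x + \int[mu]_(x in `]a, b]) h x.
Proof.
move=> ih ab; rewrite -(@Rintegral_itvB _ h -oo%O (BRight b) a).
- by rewrite addrCA subrr addr0.
- exact: intW.
- by rewrite bnd_simp.
- by rewrite bnd_simp.
Qed.

Lemma Rintegral_splitT {h : R -> R} (a : R) :
  mu.-integrable [set: R] (EFin \o h) ->
  \int[mu]_(x in [set: R]) h x =
  \int[mu]_(x in `]-oo, a]) h x + \int[mu]_(x in `]a, +oo[) h x.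
Proof.
move=> ih; rewrite -set_itvNyy -(@Rintegral_itvB _ h -oo%O +oo%O a)//.
- by rewrite addrCA subrr addr0.
- exact: intW.
Qed.

Lemma cell_estimate (a b c K : R) : a <= b ->
  (forall y, a < y <= b -> `|c - f y| <= K * g y) ->
  `|(b - a) * c - \int[mu]_(y in `]a, b]) f y| <= K * \int[mu]_(y in `]a, b]) g y.
Proof.
move=> ab H.
have mab : measurable (`]a, b] : set R) by [].
have finab : mu.-integrable `]a, b] (EFin \o cst c).
  apply: measurable_bounded_integrable => //=; last exact: bounded_cst.
  by rewrite lebesgue_measure_itv/=; case: ifP => // _; rewrite -EFinB ltry.
have -> : (b - a) * c = \int[mu]_(y in `]a, b]) (cst c) y.
  rewrite Rintegral_cst//= lebesgue_measure_itv/= lte_fin.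
  case: ltgtP ab => // [ab _|-> _].
    by rewrite mulrC -EFinB.
  by rewrite subrr mulr0 mul0r.
rewrite -RintegralB//; last exact: intW.
rewrite -RintegralZl//; last exact: intW.
apply: (le_trans (le_normr_Rintegral _ _)) => //.
  rewrite (_ : EFin \o _ = (EFin \o cst c) \- (EFin \o f))%E//.
  by apply: integrableB => //; exact: intW.
apply: le_Rintegral => //.
- rewrite (_ : EFin \o _ = abse \o ((EFin \o cst c) \- (EFin \o f)))%E//.
  by apply: integrable_abse; apply: integrableB => //; exact: intW.
- rewrite (_ : EFin \o _ = (fun x => K%:E * (EFin \o g) x))%E//.
  by apply: integrableZl => //; exact: intW.
Qed.

(** The lattice point that carries [w k] is [x k.+1], the right end of its cell: a
    point below [z] then has its whole cell below [z]. *)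
Section lattice.
Variables (x : nat -> R) (h K B : R) (N : nat) (w : nat -> R).
Hypothesis xS : forall k, x k.+1 = x k + h.
Hypothesis h0 : 0 <= h.
Hypothesis K0 : 0 <= K.
Hypothesis f0B : forall y, 0 <= f y <= B.
Hypothesis g0 : forall y, 0 <= g y.
Hypothesis fw : forall k y, (k < N)%N -> x k < y <= x k.+1 ->
  `|w k - f y| <= K * g y.
Hypothesis fl : forall y, y <= x 0%N -> f y <= K * g y.
Hypothesis fr : forall y, x N < y -> f y <= K * g y.

Local Notation Phi h z := (\int[mu]_(y in `]-oo, z]) h y).

Let hx : {homo x : i j / (i <= j)%N >-> i <= j}.
Proof.
move=> i j /subnK <-; elim: (j - i)%N => [|d ih]; first by rewrite add0n.
by rewrite addSn xS (le_trans ih)// lerDl.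
Qed.

Let le_fKg (D : set R) : measurable D -> (forall y, D y -> f y <= K * g y) ->
  \int[mu]_(y in D) f y <= K * \int[mu]_(y in D) g y.
Proof.
move=> mD fg; rewrite -RintegralZl//; last exact: intW.
apply: le_Rintegral => //; first exact: intW.
rewrite (_ : EFin \o _ = (fun x => K%:E * (EFin \o g) x))%E//.
by apply: integrableZl => //; exact: intW.
Qed.

Let Phi_mono {u : R -> R} {a b : R} : mu.-integrable [set: R] (EFin \o u) ->
  (forall y, 0 <= u y) -> a <= b -> Phi u a <= Phi u b.
Proof.
by move=> iu u0 ab; rewrite (Rintegral_split iu ab) lerDl; apply: Rintegral_ge0.
Qed.

Let partial m : (m <= N)%N ->
  `|h * \sum_(k < m) w k - Phi f (x m)| <= K * Phi g (x m).
Proof.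
elim: m => [_|m ih mN].
  rewrite big_ord0 mulr0 sub0r normrN ger0_norm; last first.
    by apply: Rintegral_ge0 => y _; case/andP: (f0B y).
  by apply: le_fKg => // y; rewrite /= in_itv/= => /fl.
have xm : x m <= x m.+1 by exact: hx.
rewrite (Rintegral_split intf xm) (Rintegral_split intg xm) big_ord_recr/=.
have := @cell_estimate (x m) (x m.+1) (w m) K xm (fun y => fw m y mN).
have -> : x m.+1 - x m = h by rewrite xS addrC addKr.
move=> c; rewrite mulrDr mulrDr opprD addrACA.
by apply: (le_trans (ler_normD _ _)); apply: lerD => //; apply: ih; exact: ltnW.
Qed.

Let Phi_step {a b : R} : a <= b -> b <= a + h -> Phi f b <= Phi f a + B * h.
Proof.
move=> ab bah; rewrite (Rintegral_split intf ab) lerD2l.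
have B0 : 0 <= B by case/andP: (f0B 0) => /le_trans; apply.
have finab : mu.-integrable `]a, b] (EFin \o cst B).
  apply: measurable_bounded_integrable => //=; last exact: bounded_cst.
  by rewrite lebesgue_measure_itv/=; case: ifP => // _; rewrite -EFinB ltry.
apply: (@le_trans _ _ (\int[mu]_(y in `]a, b]) (cst B) y)).
  by apply: le_Rintegral => //; [exact: intW|move=> y _; case/andP: (f0B y)].
rewrite Rintegral_cst//= lebesgue_measure_itv/= lte_fin.
by case: ifP => _ /=; apply: ler_wpM2l => //; lra.
Qed.

Lemma lattice_sumT :
  `|h * \sum_(k < N) w k - \int[mu]_(y in [set: R]) f y|
    <= K * \int[mu]_(y in [set: R]) g y.
Proof.
rewrite (Rintegral_splitT (x N) intf) (Rintegral_splitT (x N) intg).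
rewrite opprD addrA mulrDr; apply: (le_trans (ler_normB _ _)).
apply: lerD; first exact: partial.
rewrite ger0_norm; last by apply: Rintegral_ge0 => y _; case/andP: (f0B y).
by apply: le_fKg => // y; rewrite /= in_itv/= andbT => /fr.
Qed.

(** The term [B * h] accounts for the cell that contains [z]. *)
Lemma lattice_sum z :
  `|h * \sum_(k < N | x k.+1 <= z) w k - Phi f z|
    <= K * \int[mu]_(y in [set: R]) g y + B * h.
Proof.
have B0 : 0 <= B by case/andP: (f0B 0) => /le_trans; apply.
have f0 y : 0 <= f y by case/andP: (f0B y).
have [m mN xz] := initial_segment (fun k => x k.+1) N z
  (fun i j (ij : (i <= j)%N) => hx i.+1 j.+1 ij).
have -> : \sum_(k < N | x k.+1 <= z) w k = \sum_(k < m) w k.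
  rewrite (big_ord_widen _ w mN); apply: eq_bigl => k.
  by rewrite xz.
have Kg a : K * Phi g a <= K * \int[mu]_(y in [set: R]) g y.
  by apply: ler_wpM2l => //; rewrite (Rintegral_splitT a intg) lerDl;
    apply: Rintegral_ge0.
have Bh : 0 <= B * h by exact: mulr_ge0.
have pm := partial m mN.
move: pm (Kg (x m)); rewrite ler_norml => /andP[pm1 pm2] Km.
have zl : x m <= z \/ m = 0%N.
  by case: m {pm1 pm2 Km} mN xz => [|m] mN xz; [right|left; rewrite xz].
have zr : z <= x m.+1 \/ m = N.
  have [mN'|] := ltnP m N; last by right; apply/eqP; rewrite eqn_leq mN.
  by left; rewrite leNgt; apply/negP => /ltW; rewrite xz// ltnn.
have lo : Phi f z - h * \sum_(k < m) w k <= K * \int[mu]_(y in [set: R]) g y + B * h.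
  case: zr => [zr|mE].
    suff : Phi f z <= Phi f (x m) + B * h by lra.
    have [xz'|/ltW zx] := leP (x m) z; first by apply: Phi_step; rewrite -?xS.
    by have := Phi_mono intf f0 zx; lra.
  have : Phi f z <= \int[mu]_(y in [set: R]) f y.
    by rewrite (Rintegral_splitT z intf) lerDl; apply: Rintegral_ge0.
  by have := lattice_sumT; rewrite mE ler_norml => /andP[+ _]; lra.
rewrite ler_norml; apply/andP; split; first by lra.
case: zl => [zl|m0]; first by have := Phi_mono intf f0 zl; lra.
have : 0 <= Phi f z by apply: Rintegral_ge0.
have : 0 <= K * \int[mu]_(y in [set: R]) g y.
  by rewrite mulr_ge0//; apply: Rintegral_ge0.
by rewrite m0 big_ord0; lra.
Qed.

End lattice.

End quadrature.

(** * Local limit theorem for the spin weights *)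

Lemma quarticN {R : realType} (x : R) : quartic (- x) = quartic x.
Proof. by rewrite /quartic (_ : (- x) ^+ 4 = x ^+ 4)//; ring. Qed.

(** Working with [a = n ^ (1/4)] turns all fractional powers of [n] into integer
    powers of [a]. *)
Section closeness.
Context {R : realType}.
Variables (n : nat) (a : R).
Hypotheses (n0 : (0 < n)%N) (a0 : 0 < a) (a4 : a ^+ 4 = n%:R).

Local Notation s := (@mag R n).
Local Notation v := (@mag_weight R n).
Local Notation pt k := (s k / a ^+ 3).

Let N1 : 1 <= a ^+ 4. Proof. by rewrite a4 ler1n. Qed.

Let a2 : 0 < a ^+ 2. Proof. exact: exprn_gt0. Qed.

Let an0 : a != 0. Proof. by rewrite gt_eqF. Qed.

Let a1 : 1 <= a.
Proof. by rewrite -(@expr_ge1 _ 4)// ltW. Qed.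

(** The constant [64 = 2 ^ 6] makes the lower bound on the weight trivial for
    [s k > n / 2], where the telescoped lower bound is not available, and
    [expR 2] is room for [expR (5 / 4)], the largest overshoot of a weight. *)
Lemma mag_weight_close_half {k} : (uphalf n <= k <= n)%N ->
  `|v k / v (uphalf n) - quartic (pt k)| <=
  (64 + 2 * expR 2) / a ^+ 2 * ((pt k ^+ 2 + pt k ^+ 6) * quartic (pt k)).
Proof.
move=> /andP[nk kn]; set E := expR 2.
have hn : (uphalf n <= n)%N by exact: leq_trans kn.
have v0 := @mag_weight_gt0 R n _ hn.
have := @mag_telescope R n n0 (k - uphalf n); rewrite subnKC// => /(_ kn)/=[s0].
rewrite -a4.
have -> : - s k ^+ 4 / (12 * (a ^+ 4) ^+ 3) = - (pt k ^+ 4 / 12).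
  by field; rewrite an0.
have -> : s k ^+ 2 / (a ^+ 4) ^+ 2 = pt k ^+ 2 / a ^+ 2.
  by field; rewrite an0.
have -> : s k ^+ 6 / (a ^+ 4) ^+ 5 = pt k ^+ 6 / a ^+ 2.
  by field; rewrite an0.
rewrite !expRD -/(quartic _) ![v (uphalf n) * _]mulrC.
rewrite -ler_pdivrMr// => up lo'.
have lo : 2 * s k <= a ^+ 4 ->
    quartic (pt k) * expR (- (pt k ^+ 6 / a ^+ 2)) <= v k / v (uphalf n).
  by move=> h; rewrite ler_pdivlMr//; exact: lo'.
have w0 : 0 <= v k / v (uphalf n) by rewrite divr_ge0 ?ltW ?mag_weight_gt0.
move: w0 up lo; move: (v k / v (uphalf n)) => w w0 up lo {lo'}.
have sn : s k <= a ^+ 4.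
  have : k%:R <= n%:R :> R by rewrite ler_nat.
  by rewrite a4 /mag; lra.
have q0 := quartic_ge0 (pt k).
have x2 : 0 <= pt k ^+ 2 / a ^+ 2 by rewrite divr_ge0 ?sqr_ge0// ltW.
have x6 : 0 <= pt k ^+ 6 / a ^+ 2.
  by rewrite divr_ge0 ?(ltW a2)// exprn_even_ge0.
have d1 : pt k ^+ 2 / a ^+ 2 <= 1.
  rewrite (_ : _ / _ = (s k / a ^+ 4) ^+ 2); last by field; rewrite an0.
  have ? : 0 <= s k / a ^+ 4 by rewrite divr_ge0// (le_trans _ N1).
  by rewrite expr_le1// ler_pdivrMr ?mul1r// (lt_le_trans _ N1).
have d6 : a ^+ 4 < 2 * s k -> 1 <= 64 * (pt k ^+ 6 / a ^+ 2).
  move=> as2; rewrite (_ : 64 * _ = (2 * s k / a ^+ 4) ^+ 6 * a ^+ 4);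
    last by field; rewrite an0.
  rewrite -[leLHS]mul1r; apply: ler_pM => //.
  by rewrite exprn_ege1// ler_pdivlMr ?mul1r ?ltW// (lt_le_trans _ N1).
rewrite [leRHS](_ : _ =
   quartic (pt k) * ((64 + 2 * E) * (pt k ^+ 2 / a ^+ 2 + pt k ^+ 6 / a ^+ 2)));
  last by ring.
move: x2 x6 d1 d6 up lo.
move: (pt k ^+ 2 / _) (pt k ^+ 6 / _) (quartic _) q0 => d e q q0 d0 e0 d1 e6 up lo.
have E0 : 0 < E by exact: expR_gt0.
rewrite ler_norml; apply/andP; split.
  suff h : q * (1 - 64 * e) <= w.
    have : 0 <= q * (64 * d + 2 * E * (d + e)) by rewrite mulr_ge0//; nra.
    by lra.
  have [h|/e6 h] := leP (2 * s k) (a ^+ 4).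
    apply: le_trans (lo h); apply: ler_wpM2l => //.
    by have := expR_ge1Dx (- e); lra.
  apply: (@le_trans _ _ 0); first by nra.
  by [].
have h : expR (5 / 4 * d) - 1 <= 5 / 4 * d * E.
  by apply: expR_near1; lra.
have h' : q * (expR (5 / 4 * d) - 1) <= q * (2 * E * (d + e)).
  apply: ler_wpM2l => //; apply: (le_trans h); nra.
have : 0 <= q * (64 * (d + e)) by rewrite mulr_ge0//; lra.
by lra.
Qed.

(** Reflection reduces the lower half of the lattice to the upper one. *)
Lemma mag_weight_close {k} : (k <= n)%N ->
  `|v k / v (uphalf n) - quartic (pt k)| <=
  1152 * (64 + 2 * expR 2) / a ^+ 2 * (oneDsqr (pt k))^-1.
Proof.
move=> kn; apply: (@le_trans _ _ ((64 + 2 * expR 2) / a ^+ 2 *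
    ((pt k ^+ 2 + pt k ^+ 6) * quartic (pt k)))); last first.
  have M0 : 0 <= (64 + 2 * expR 2) / a ^+ 2.
    by rewrite divr_ge0 ?(ltW a2)// addr_ge0// mulr_ge0// expR_ge0.
  apply: (le_trans (ler_wpM2l M0 (poly_quartic_le _))).
  by rewrite le_eqVlt; apply/predU1P; left; ring.
have [nk|nk] := leqP (uphalf n) k; first by apply: mag_weight_close_half; rewrite nk.
have ck : (uphalf n <= n - k <= n)%N.
  rewrite leq_subr andbT; move: nk kn; rewrite uphalf_half.
  by have := odd_double_half n; lia.
have := mag_weight_close_half ck; rewrite mag_weight_rev// mag_rev// mulNr quarticN.
rewrite sqrrN (_ : (- pt k) ^+ 6 = pt k ^+ 6)//; ring.
Qed.

End closeness.

Section integrability.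
Context {R : realType}.
Local Notation mu := (@lebesgue_measure R).

Lemma integrable_oneDsqrV :
  mu.-integrable [set: R] (EFin \o (fun x : R => (oneDsqr x)^-1)).
Proof.
have g0 (x : R) : 0 <= (oneDsqr x)^-1 by rewrite invr_ge0 (le_trans ler01)// oneDsqr_ge1.
have cg : continuous (fun x : R => (oneDsqr x)^-1) by exact: continuous_oneDsqrV.
apply/integrableP; split.
  by apply/measurable_EFinP; exact: continuous_measurable_fun.
under eq_integral do rewrite /= ger0_norm//.
rewrite ge0_symfun_integralT//.
  rewrite (_ : [set x | (0 <= x)%R] = `[0%R, +oo[%classic); last first.
    by apply/seteqP; split => x /=; rewrite in_itv/= andbT.
  by rewrite integral0y_oneDsqr -EFinM ltry.
by move=> x; rewrite /= /oneDsqr sqrrN.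
Qed.

Lemma integrable_quartic : mu.-integrable [set: R] (EFin \o quartic).
Proof.
have cq : continuous (@quartic R).
  move=> x; apply: differentiable_continuous; apply/derivable1_diffP.
  exact: (@ex_derive _ _ _ _ _ _ _ (is_derive_quartic x)).
have iK := integrableZl measurableT 1152 integrable_oneDsqrV.
apply: le_integrable iK => //.
  by apply/measurable_EFinP; exact: continuous_measurable_fun.
move=> x _ /=; rewrite lee_fin ger0_norm ?quartic_ge0//.
rewrite ger0_norm; last first.
  by rewrite mulr_ge0 ?ler0n// invr_ge0 (le_trans ler01)// oneDsqr_ge1.
rewrite -[leLHS]mul1r; apply: quartic_decay_div; first exact: ler01.
have -> : x ^+ 4 = (x ^+ 2) ^+ 2 by rewrite -exprM.
by move: (x ^+ 2) (sqr_ge0 x) => v v0; have := sqr_ge0 (v - 1); nra.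
Qed.

Lemma quartic_Z_gt0 : 0 < @quartic_Z R.
Proof.
have q0 x : 0 <= @quartic R x by exact: quartic_ge0.
apply: (@lt_le_trans _ _ (\int[mu]_(x in `]0, 1]) (cst (quartic 1) x))).
  rewrite Rintegral_cst//= lebesgue_measure_itv/= lte_fin ltr01 /= subr0 mulr1.
  exact: expR_gt0.
rewrite /quartic_Z (Rintegral_splitT 1 integrable_quartic).
rewrite (Rintegral_split integrable_quartic ler01).
have : \int[mu]_(x in `]0, 1]) (cst (quartic 1) x) <= \int[mu]_(x in `]0, 1]) quartic x.
  apply: le_Rintegral => //.
  - apply: measurable_bounded_integrable => //=; last exact: bounded_cst.
    by rewrite lebesgue_measure_itv/= lte_fin ltr01 -EFinB ltry.
  - by apply: integrableS integrable_quartic.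
  - move=> x; rewrite /= in_itv/= => /andP[x0 x1].
    rewrite /quartic ler_expR lerN2 ler_pM2r// expr1n.
    by rewrite exprn_ile1// ltW.
move=> /le_trans; apply.
rewrite ler_wpDr ?ler_wpDl//; exact: Rintegral_ge0.
Qed.

End integrability.

(** * The law of the magnetization *)

Section distribution.
Context {R : realType}.
Variable n : nat.

Definition up_spins (x : n.-tuple bool) : {set 'I_n} :=
  [set i | tnth x i]%SET.

Lemma sum_card_draws (F : nat -> R) :
  \sum_(x : n.-tuple bool) F #|up_spins x| =
  \sum_(k < n.+1) 'C(n, k)%:R * F k.
Proof.
pose T (A : {set 'I_n}) : n.-tuple bool := [tuple i \in A | i < n].
have TK : cancel T up_spins.
  by move=> A; apply/finset.setP => i; rewrite inE tnth_mktuple.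
have KT : cancel up_spins T.
  by move=> x; apply: eq_from_tnth => i; rewrite tnth_mktuple inE.
rewrite (reindex T); last by exists up_spins => ? _.
under eq_bigr do rewrite TK.
have szA (A : {set 'I_n}) : (#|A| < n.+1)%N by rewrite ltnS -[leqRHS]card_ord max_card.
rewrite (partition_big (fun A => Ordinal (szA A)) xpredT)//=.
apply: eq_bigr => k _.
rewrite (eq_bigr (fun=> F k)); last by move=> A /eqP <-.
rewrite sumr_const -[LHS]mulr_natl; congr (_%:R * _).
rewrite -[n in 'C(n, _)]card_ord -card_draws -sum1_card -[RHS]sum1_card.
by apply: eq_bigl => A; rewrite !inE.
Qed.

Lemma cw_S_mag (x : n.-tuple bool) : cw_S x = mag n #|up_spins x| :> R.
Proof.
rewrite /cw_S /mag -sum1_card natr_sum mulr_sumr [X in X - _]big_mkcond/=.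
have -> : n%:R = \sum_(i < n) 1 :> R by rewrite sumr_const card_ord.
rewrite -sumrB; apply: eq_bigr => i _; rewrite /cw_X /spin inE.
by case: ifP => _; lra.
Qed.

Lemma cw_weight_mag (x : n.-tuple bool) : cw_weight 1 x =
  expR (mag n #|up_spins x| ^+ 2 / (2 * n%:R)) * (2^-1) ^+ n :> R.
Proof.
rewrite /cw_weight cw_S_mag; congr (expR _ * _); first by rewrite mul1r mulrC.
under eq_bigr do rewrite /cw_X rho_spin/=.
by rewrite prodr_const card_ord.
Qed.

Lemma cw_prob_mag (P : pred R) :
  cw_prob 1 [set x : n.-tuple bool | P (cw_S x)] =
  ((\sum_(k < n.+1 | P (mag n k)) mag_weight n k) /
   (\sum_(k < n.+1) @mag_weight R n k))%:E.
Proof.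
have Zmag : cw_Z n (1 : R) = (2^-1) ^+ n * \sum_(k < n.+1) mag_weight n k.
  rewrite /cw_Z; under eq_bigr do rewrite cw_weight_mag.
  rewrite (sum_card_draws (fun k => expR (mag n k ^+ 2 / (2 * n%:R)) * (2^-1) ^+ n)).
  by rewrite mulr_sumr; apply: eq_bigr => k _; rewrite mulrA mulrC.
have h0 : (2^-1 : R) ^+ n != 0 by rewrite expf_neq0// invr_eq0 pnatr_eq0.
rewrite /cw_prob; under eq_bigr do rewrite diracE -EFinM.
rewrite sumEFin; congr EFin.
pose F k : R := expR (mag n k ^+ 2 / (2 * n%:R)) * (2^-1) ^+ n / cw_Z n (1 : R)
  * (P (mag n k))%:R.
transitivity (\sum_(x : n.-tuple bool) F #|up_spins x|).
  apply: eq_bigr => x _; rewrite cw_weight_mag /F; congr (_ * _%:R).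
  by rewrite -cw_S_mag; congr nat_of_bool; apply/idP/idP; rewrite inE.
rewrite sum_card_draws [in RHS]big_mkcond/= mulr_suml; apply: eq_bigr => k _.
rewrite /F Zmag; move: (\sum_(_ < _) _) => Z.
case: ifP => _; last by rewrite !mulr0 mul0r.
rewrite mulr1 /mag_weight [(_ * Z)^-1]invfM.
move: (Z^-1) (_ ^+ n) h0 (expR _) => z t t0 e.
by field.
Qed.

End distribution.

(** Writing the difference as [((A - I) + A / T * (J - T)) / J] makes the error on
    [T] enter only through the ratio [A / T <= 1]. *)
Lemma normalized_dist {R : realFieldType} (A T I J e f : R) :
  0 < J -> 0 < T -> 0 <= A <= T -> `|A - I| <= e -> `|T - J| <= f ->
  `|A / T - J^-1 * I| <= (e + f) / J.
Proof.
move=> J0 T0 /andP[A0 AT] AI TJ.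
have -> : A / T - J^-1 * I = ((A - I) + A / T * (J - T)) / J.
  by field; rewrite !gt_eqF.
rewrite normrM [`|J^-1|]gtr0_norm ?invr_gt0// ler_pM2r ?invr_gt0//.
apply: (le_trans (ler_normD _ _)); apply: lerD => //.
rewrite normrM -[leRHS]mul1r; apply: ler_pM => //; last by rewrite distrC.
by rewrite ger0_norm ?divr_ge0// ?(ltW T0)// ler_pdivrMr// mul1r.
Qed.

(** * Rate of convergence *)

Section rate.
Context {R : realType}.
Local Notation mu := (@lebesgue_measure R).
Let M : R := 64 + 2 * expR 2.
Let G : R := \int[mu]_(y in [set: R]) (oneDsqr y)^-1.

Let M0 : 0 <= M.
Proof. by rewrite addr_ge0 ?mulr_ge0 ?ler0n ?expR_ge0. Qed.

(** Passing from the lattice point to the rest of its cell costs the oscillation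
    of [quartic], of order [h = 2 / a ^+ 3 <= 2 / a ^+ 2]. *)
Lemma lattice_cell (n : nat) (a : R) (k : nat) (y : R) :
  (0 < n)%N -> 0 < a -> a ^+ 4 = n%:R -> (k <= n)%N ->
  mag n k / a ^+ 3 - 2 / a ^+ 3 < y <= mag n k / a ^+ 3 ->
  `|mag_weight n k / mag_weight n (uphalf n) - quartic y| <=
  10368 * (M + 2) / a ^+ 2 * (oneDsqr y)^-1.
Proof.
move=> n0 a0 a4 kn yk.
have a1 : 1 <= a by rewrite -(@expr_ge1 _ 4) ?a4 ?ler1n// ltW.
have a2 : 0 < a ^+ 2 by exact: exprn_gt0.
have a3 : 0 < a ^+ 3 by exact: exprn_gt0.
have h1 : 2 / a ^+ 3 <= 2 / a ^+ 2.
  by rewrite ler_pM2l ?ltr0n// lef_pV2 ?posrE//; exact: ler_weXn2l.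
have h2 : 2 / a ^+ 3 <= 2 by rewrite ler_pdivrMr// ler_peMr// exprn_ege1.
have g0 : 0 <= (oneDsqr y)^-1 by rewrite invr_ge0 (le_trans ler01)// oneDsqr_ge1.
have cl := mag_weight_close _ _ n0 a0 a4 kn.
have lp : `|quartic (mag n k / a ^+ 3) - quartic y| <=
    10368 * (2 / a ^+ 3) * (oneDsqr y)^-1.
  by apply: quartic_lip => //; case/andP: yk => /ltW -> ->.
have sh : (oneDsqr (mag n k / a ^+ 3))^-1 <= 9 * (oneDsqr y)^-1.
  apply: oneDsqrV_shift; move: yk h2.
  move: (2 / a ^+ 3) (mag n k / a ^+ 3) => h x /andP[? ?] ?.
  by rewrite ler_norml; apply/andP; split; lra.
rewrite (_ : _ - _ =
  (mag_weight n k / mag_weight n (uphalf n) - quartic (mag n k / a ^+ 3))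
  + (quartic (mag n k / a ^+ 3) - quartic y)); last by ring.
apply: (le_trans (ler_normD _ _)).
have -> : 10368 * (M + 2) / a ^+ 2 * (oneDsqr y)^-1 =
   1152 * M / a ^+ 2 * (9 * (oneDsqr y)^-1) + 10368 * (2 / a ^+ 2) * (oneDsqr y)^-1.
  by ring.
apply: lerD.
  apply: (le_trans cl); apply: ler_wpM2l sh.
  by apply: divr_ge0; [apply: mulr_ge0; [exact: ler0n|exact: M0]|exact: ltW].
apply: (le_trans lp); apply: (ler_wpM2r g0).
by apply: ler_wpM2l h1; exact: ler0n.
Qed.

Lemma cw_rate : exists C : R, forall (n : nat) (a z : R),
  (0 < n)%N -> 0 < a -> a ^+ 4 = n%:R ->
  `|(\sum_(k < n.+1 | mag n k / a ^+ 3 <= z) mag_weight n k)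
      / (\sum_(k < n.+1) mag_weight n k) - quartic_F z| <= C / a ^+ 2.
Proof.
(* the error of the sum up to [z] and that of the whole sum, plus one cell *)
exists ((2 * (10368 * (M + 2)) * G + 2) / quartic_Z) => n a z n0 a0 a4.
have a1 : 1 <= a by rewrite -(@expr_ge1 _ 4) ?a4 ?ler1n// ltW.
have a2 : 0 < a ^+ 2 by exact: exprn_gt0.
have a3 : 0 < a ^+ 3 by exact: exprn_gt0.
have h1 : 2 / a ^+ 3 <= 2 / a ^+ 2.
  by rewrite ler_pM2l ?ltr0n// lef_pV2 ?posrE//; exact: ler_weXn2l.
have hn : (uphalf n <= n)%N by rewrite uphalf_half; have := odd_double_half n; lia.
pose v k : R := mag_weight n k; pose v0 := v (uphalf n).
have v00 : 0 < v0 by exact: mag_weight_gt0.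
pose h := 2 / a ^+ 3.
have h0 : 0 < h by rewrite divr_gt0.
pose K := 10368 * (M + 2) / a ^+ 2.
have K0 : 0 <= K.
  apply: divr_ge0; last exact: ltW.
  by apply: mulr_ge0; [exact: ler0n|exact: addr_ge0].
(* left end points of the cells: the lattice point of [k] is [x k.+1] *)
pose x (k : nat) : R := mag n k / a ^+ 3 - h.
have xS k : x k.+1 = x k + h by rewrite /x /h magS; ring.
have xE k : x k.+1 = mag n k / a ^+ 3 by rewrite xS /x subrK.
have g0 (y : R) : 0 <= (oneDsqr y)^-1 by rewrite invr_ge0 (le_trans ler01)// oneDsqr_ge1.
have q01 (y : R) : 0 <= quartic y <= 1 by rewrite quartic_ge0 quartic_le1.
have far y : a <= `|y| -> quartic y <= K * (oneDsqr y)^-1.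
  move=> ay; apply: (le_trans (quartic_tail _ _ a0 ay)).
  apply: (ler_wpM2r (g0 y)); apply: ler_wpM2r; first by rewrite invr_ge0 ltW.
  by move: (M) M0 => m m0; lra.
have cell k y : (k < n.+1)%N -> x k < y <= x k.+1 ->
    `|v k / v0 - quartic y| <= K * (oneDsqr y)^-1.
  by rewrite xE ltnS => kn yk; exact: lattice_cell.
have aE : a ^+ 4 / a ^+ 3 = a by field; rewrite gt_eqF.
have fl y : y <= x 0%N -> quartic y <= K * (oneDsqr y)^-1.
  move=> yx; apply: far; rewrite -normrN; apply: le_trans (ler_norm _).
  have : x 0%N <= - a.
    rewrite /x /mag mulr0 sub0r -a4 mulNr aE; lra.
  by lra.
have fr y : x n.+1 < y -> quartic y <= K * (oneDsqr y)^-1.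
  rewrite xE /mag -a4 (_ : 2 * _ - _ = a ^+ 4); last by lra.
  by rewrite aE => ay; apply: far; apply: le_trans (ler_norm _); exact: ltW.
have main := lattice_sum _ _ integrable_quartic integrable_oneDsqrV x h K 1 n.+1
  (fun k => v k / v0) xS (ltW h0) K0 q01 g0 cell fl fr z.
have tot := lattice_sumT _ _ integrable_quartic integrable_oneDsqrV x h K 1 n.+1
  (fun k => v k / v0) xS (ltW h0) q01 cell fl fr.
rewrite -/G in main tot.
have scale (P : pred nat) : h * (\sum_(k < n.+1 | P k) v k / v0)
    = h / v0 * \sum_(k < n.+1 | P k) v k.
  by rewrite -mulr_suml -mulrA [_ / v0]mulrC.
rewrite (scale (fun k => x k.+1 <= z)) in main; rewrite (scale xpredT) in tot.
have eqS : \sum_(k < n.+1 | x k.+1 <= z) v k =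
    \sum_(k < n.+1 | mag n k / a ^+ 3 <= z) v k.
  by apply: eq_bigl => k; rewrite xE.
rewrite {}eqS in main.
have hv : 0 < h / v0 by rewrite divr_gt0.
have v_ge0 (k : 'I_n.+1) : 0 <= v k.
  by apply: ltW; apply: mag_weight_gt0; rewrite -ltnS.
have T0 : 0 < \sum_(k < n.+1) v k.
  rewrite (bigD1 ord_max)//= ltr_pwDl ?mag_weight_gt0//.
  by apply: sumr_ge0 => k _.
have A0 : 0 <= \sum_(k < n.+1 | mag n k / a ^+ 3 <= z) v k by apply: sumr_ge0.
have AT : \sum_(k < n.+1 | mag n k / a ^+ 3 <= z) v k <= \sum_(k < n.+1) v k.
  by rewrite big_mkcond/= ler_sum// => k _; case: ifP.
move: main tot T0 A0 AT; rewrite /v.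
move: (\sum_(k < n.+1 | _) _) (\sum_(k < n.+1) _) => A T main tot T0 A0 AT.
have hv0 : h / v0 != 0 by rewrite gt_eqF.
have -> : A / T = (h / v0 * A) / (h / v0 * T).
  by rewrite -mulf_div divff// mul1r.
have AT' : 0 <= h / v0 * A <= h / v0 * T.
  by rewrite ler_wpM2l ?(ltW hv)// mulr_ge0// ltW.
have := normalized_dist _ _ _ _ _ _ quartic_Z_gt0 (mulr_gt0 hv T0) AT' main tot.
rewrite -/(quartic_F z) => /le_trans; apply.
have Z0 := @quartic_Z_gt0 R.
rewrite [leRHS]mulrAC ler_pM2r ?invr_gt0//.
rewrite [leRHS](_ : _ = K * G + 1 * (2 / a ^+ 2) + K * G); last by rewrite /K; ring.
by rewrite lerD2r lerD2l !mul1r.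
Qed.

End rate.

Theorem theorem1p3 (R : realType) :
  exists C : R, forall n : nat, (1 <= n)%N ->
    (ereal_sup (range (fun z : R =>
       `|cw_prob 1 [set x : n.-tuple bool | (cw_S x / n%:R `^ (3 / 4) <= z)%R]
         - (quartic_F z)%:E|))
     <= (C * n%:R `^ (- (1 / 2)))%:E)%E.
Proof.
have [C cw_rateC] := @cw_rate R; exists C => n n0.
pose a : R := n%:R `^ (1 / 4).
have nR : 0 < n%:R :> R by rewrite ltr0n.
have a0 : 0 < a by exact: powR_gt0.
have aX k : a ^+ k = n%:R `^ (k%:R / 4).
  by rewrite /a -powR_mulrn ?powR_ge0// -powRrM; congr (_ `^ _); ring.
have a4 : a ^+ 4 = n%:R by rewrite aX divff ?pnatr_eq0// powRr1// ltW.
have -> : n%:R `^ (- (1 / 2)) = (a ^+ 2)^-1.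
  by rewrite aX powRN; congr (_ `^ _)^-1; field.
rewrite -(aX 3).
apply: ge_ereal_sup => _ [z _ <-].
rewrite (cw_prob_mag n (fun s => s / a ^+ 3 <= z)).
rewrite -EFinB abse_EFin lee_fin.
exact: cw_rateC.
Qed.
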